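(* For every composition $\mathbf{s}=(s_1,\ldots,s_k)$ and every positive integer $r$, the family (indexed by primes $p$) \[ p^{w(\mathbf{s})}H^{(p)}_{pr}(\mathbf{s}):=p^{w(\mathbf{s})}\sum_{\substack{pr\geq n_1>\cdots>n_k\geq1\\ p\nmid n_1n_2\cdots n_k}}\frac{1}{n_1^{s_1}\cdots n_k^{s_k}} \] is asymptotically representable.
   Context: A composition is a finite ordered tuple $\mathbf{s}=(s_1,\ldots,s_k)$ of positive integers (empty allowed), weight $w(\mathbf{s})=\sum s_i$; $H_n(\mathbf{s})=\sum_{n\geq n_1>\cdots>n_k\geq1}n_1^{-s_1}\cdots n_k^{-s_k}$, $H_n(\varnothing)=1$. A collection $a_p\in\mathbb{Z}_p$ (defined for all but finitely many primes $p$) is asymptotically representable if there are coefficients $\alpha_{\mathbf{s}}\in\mathbb{Q}$, one for each composition and independent of $p$, such that for every $n\geq1$ the congruence $a_p\equiv\sum_{w(\mathbf{s})<n}\alpha_{\mathbf{s}}p^{w(\mathbf{s})}H_{p-1}(\mathbf{s})\pmod{p^n}$ holds for all sufficiently large $p$. *)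

(* Defs.v *)
From HB Require Import structures.
From mathcomp Require Import all_boot all_order all_algebra.
From mathcomp Require Import zify.
From mathcomp Require Import boolp classical_sets cardinality fsbigop.

Set Implicit Arguments.
Unset Strict Implicit.
Unset Printing Implicit Defensive.

Import Order.TTheory GRing.Theory Num.Theory.

Local Open Scope ring_scope.

(* The ring of p-adic integers is the inverse limit of the rings Z/p^(n+1),
   n >= 0.  The exponent is shifted because 'Z_1 is not the zero ring.
   Everything below is meaningful for 1 < p only. *)

Lemma expn_gt1 (p n : nat) : (1 < p)%N -> (1 < p ^ n.+1)%N.
Proof. by move=> p_gt1; rewrite -(exp1n n.+1) ltn_exp2r. Qed.

Definition Zp_red (p n : nat) (x : 'Z_(p ^ n.+2)) : 'Z_(p ^ n.+1) :=
  (x : nat)%:R.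

Record padic_int (p : nat) := PadicInt {
  residue : forall n : nat, 'Z_(p ^ n.+1);
  residueP : forall n : nat, Zp_red (residue n.+1) = residue n
}.

Section ZpRed.
Variables p n : nat.

Lemma Zp_red_nat (m : nat) : Zp_red (m%:R : 'Z_(p ^ n.+2)) = m%:R.
Proof.
rewrite /Zp_red !Zp_nat; apply: val_inj; rewrite /= modn_dvdm //.
have [p_gt1|] := ltnP 1 p; last by case: p => [|[|]] //; rewrite !(exp0n, exp1n).
by rewrite !Zp_cast ?dvdn_exp2l ?expn_gt1.
Qed.

Lemma Zp_redM : {morph @Zp_red p n : x y / x * y}.
Proof.
move=> x y; rewrite -[x in LHS]natr_Zp -[y in LHS]natr_Zp -natrM Zp_red_nat.
by rewrite natrM.
Qed.

Lemma Zp_redD : {morph @Zp_red p n : x y / x + y}.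
Proof.
move=> x y; rewrite -[x in LHS]natr_Zp -[y in LHS]natr_Zp -natrD Zp_red_nat.
by rewrite natrD.
Qed.

Lemma Zp_red0 : @Zp_red p n 0 = 0. Proof. exact: (Zp_red_nat 0). Qed.

Lemma Zp_red1 : @Zp_red p n 1 = 1. Proof. exact: (Zp_red_nat 1). Qed.

Lemma Zp_redN : {morph @Zp_red p n : x / - x}.
Proof. by move=> x; apply/eqP; rewrite -addr_eq0 -Zp_redD addNr Zp_red0. Qed.

Lemma Zp_red_int (m : int) : Zp_red (m%:~R : 'Z_(p ^ n.+2)) = m%:~R.
Proof.
by case: m => m; rewrite ?NegzE ?mulrNz ?Zp_redN -pmulrn Zp_red_nat.
Qed.

Lemma Zp_redV : {morph @Zp_red p n : x / x^-1}.
Proof.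
have unitE m : ((m%:R : 'Z_(p ^ n.+2)) \is a GRing.unit)
             = ((m%:R : 'Z_(p ^ n.+1)) \is a GRing.unit).
  have [p_gt1|] := ltnP 1 p; last first.
    by case: p => [|[|]] //; rewrite !(exp0n, exp1n).
  by rewrite !unitZpE ?expn_gt1 // !coprime_pexpl.
move=> x; rewrite -[x]natr_Zp; set m := (x : nat).
have [um|num] := boolP ((m%:R : 'Z_(p ^ n.+2)) \is a GRing.unit).
  have um' := um; rewrite unitE in um'.
  apply: (mulIr um'); rewrite [in RHS]Zp_red_nat mulVr //.
  by rewrite -[X in _ * X]Zp_red_nat -Zp_redM mulVr // Zp_red1.
by rewrite invr_out // Zp_red_nat invr_out // -unitE.
Qed.

End ZpRed.

Section PadicRing.
Variable p : nat.
Implicit Types x y z : padic_int p.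

Lemma padic_int_ext x y : (forall n, residue x n = residue y n) -> x = y.
Proof.
case: x => x xP; case: y => y yP /= xy.
have {}xy := functional_extensionality_dep xy; rewrite -{}xy in yP *.
by rewrite (Prop_irrelevance xP yP).
Qed.

Definition padic_zero : padic_int p :=
  @PadicInt p (fun _ => 0) (fun n => Zp_red0 p n).

Definition padic_one : padic_int p :=
  @PadicInt p (fun _ => 1) (fun n => Zp_red1 p n).

Program Definition padic_opp x : padic_int p :=
  @PadicInt p (fun n => - residue x n) _.
Next Obligation. by rewrite Zp_redN residueP. Qed.

Program Definition padic_add x y : padic_int p :=
  @PadicInt p (fun n => residue x n + residue y n) _.
Next Obligation. by rewrite Zp_redD !residueP. Qed.

Program Definition padic_mul x y : padic_int p :=
  @PadicInt p (fun n => residue x n * residue y n) _.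
Next Obligation. by rewrite Zp_redM !residueP. Qed.

HB.instance Definition _ := gen_eqMixin (padic_int p).
HB.instance Definition _ := gen_choiceMixin (padic_int p).

Lemma padic_addA : associative padic_add.
Proof. by move=> x y z; apply: padic_int_ext => n /=; rewrite addrA. Qed.
Lemma padic_addC : commutative padic_add.
Proof. by move=> x y; apply: padic_int_ext => n /=; rewrite addrC. Qed.
Lemma padic_add0 : left_id padic_zero padic_add.
Proof. by move=> x; apply: padic_int_ext => n /=; rewrite add0r. Qed.
Lemma padic_addN : left_inverse padic_zero padic_opp padic_add.
Proof. by move=> x; apply: padic_int_ext => n /=; rewrite addNr. Qed.
Lemma padic_mulA : associative padic_mul.
Proof. by move=> x y z; apply: padic_int_ext => n /=; rewrite mulrA. Qed.
Lemma padic_mulC : commutative padic_mul.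
Proof. by move=> x y; apply: padic_int_ext => n /=; rewrite mulrC. Qed.
Lemma padic_mul1 : left_id padic_one padic_mul.
Proof. by move=> x; apply: padic_int_ext => n /=; rewrite mul1r. Qed.
Lemma padic_mulD : left_distributive padic_mul padic_add.
Proof. by move=> x y z; apply: padic_int_ext => n /=; rewrite mulrDl. Qed.
Lemma padic_one_neq0 : padic_one != padic_zero.
Proof.
apply/eqP => /(congr1 (fun x => residue x 0)) /= /eqP.
by rewrite oner_eq0.
Qed.

HB.instance Definition _ := GRing.isZmodule.Build (padic_int p)
  padic_addA padic_addC padic_add0 padic_addN.
HB.instance Definition _ := GRing.Zmodule_isComNzRing.Build (padic_int p)
  padic_mulA padic_mulC padic_mul1 padic_mulD padic_one_neq0.

(* The embedding of Z_(p) = Q :&: Z_p into Z_p; a junk value when p divides the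
   denominator of q. *)
Program Definition padic_of_rat (q : rat) : padic_int p :=
  @PadicInt p (fun n => (numq q)%:~R / (denq q)%:~R) _.
Next Obligation. by rewrite Zp_redM Zp_redV !Zp_red_int. Qed.

Definition p_integral (q : rat) : bool := ~~ (p %| `|denq q|)%N.

Lemma residueD x y n : residue (x + y) n = residue x n + residue y n.
Proof. by []. Qed.
Lemma residueM x y n : residue (x * y) n = residue x n * residue y n.
Proof. by []. Qed.
Lemma residue_nat m n : residue (m%:R : padic_int p) n = m%:R.
Proof. by elim: m => // m IHm; rewrite !mulrSr residueD IHm. Qed.

Lemma residue_int (m : int) n : residue (m%:~R : padic_int p) n = m%:~R.
Proof. by case: m => m; rewrite ?NegzE ?mulrNz -!pmulrn /= residue_nat. Qed.

Lemma padic_of_ratP (q : rat) : prime p -> p_integral q ->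
  (denq q)%:~R * padic_of_rat q = (numq q)%:~R.
Proof.
move=> p_pr q_int; apply: padic_int_ext => n.
rewrite residueM !residue_int /= mulrCA mulrV ?mulr1 //.
rewrite -[denq q]gez0_abs ?denq_ge0 // -pmulrn.
by rewrite unitZpE ?expn_gt1 ?prime_gt1 // coprime_pexpl // prime_coprime.
Qed.

(* a = q mod p^n, where the rational number q is required to lie in Z_p. *)
Definition padic_congr (n : nat) (a : padic_int p) (q : rat) : Prop :=
  p_integral q /\ exists z : padic_int p, a - padic_of_rat q = p%:R ^+ n * z.

End PadicRing.

Definition composition : Type := {s : seq nat | all (leq 1) s}.

Definition weight (s : composition) : nat := sumn (val s).

Lemma finite_weight_lt (n : nat) :
  finite_set [set s : composition | (weight s < n)%N].
Proof.
have [l lP] : exists l : seq (seq nat),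
    forall t, all (leq 1) t -> (sumn t < n)%N -> t \in l.
  elim: n => [|n [l IHl]]; first by exists [::].
  exists ([::] :: [seq a :: t | a <- iota 0 n.+1, t <- l]) => -[|a t] //.
  move=> /andP[a_gt0 t_gt0] at_n; rewrite inE orFb.
  apply/allpairsP; exists (a, t).
  rewrite -[(a, t).1]/a -[(a, t).2]/t; split=> //; last first.
    by apply: IHl => //; move: at_n a_gt0 => /=; lia.
  by rewrite mem_iota; move: at_n => /=; lia.
apply: (@sub_finite_set _ _ [set` pmap insub l : seq composition]) => //.
by move=> s /= s_n; rewrite mem_pmap_sub; apply: lP => //; apply: valP.
Qed.

(* The depth k is [size s]; a function t : 'I_k -> {0..n} stands for the tuple
   (n_1, ..., n_k). *)
Section HarmonicSums.
Variable s : composition.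
Local Notation k := (size (val s)).

Definition chain (n : nat) (t : {ffun 'I_k -> 'I_n.+1}) : bool :=
  [forall i : 'I_k, 0 < t i]%N &&
  [forall i : 'I_k, forall j : 'I_k, (i < j) ==> (t j < t i)]%N.

Definition harmonic_term (n : nat) (t : {ffun 'I_k -> 'I_n.+1}) : rat :=
  \prod_(i < k) ((t i)%:R ^+ nth 0%N (val s) i)^-1.

Definition mhs (n : nat) : rat :=
  \sum_(t : {ffun 'I_k -> 'I_n.+1} | chain t) harmonic_term t.

Definition mhs_coprime (p n : nat) : rat :=
  \sum_(t : {ffun 'I_k -> 'I_n.+1} | chain t && ~~ (p %| \prod_(i < k) t i)%N)
     harmonic_term t.

End HarmonicSums.

(* For a given n only all sufficiently large primes p are constrained, so the
   values of [a] at finitely many primes, and at non-primes, are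
   irrelevant.  The index set of the sum is finite
   by [finite_weight_lt], so the finitely supported sum is the genuine sum. *)
Definition asymptotically_representable (a : forall p : nat, padic_int p) :
    Prop :=
  exists alpha : composition -> rat,
    forall n : nat, (1 <= n)%N ->
      exists N : nat, forall p : nat, prime p -> (N <= p)%N ->
        padic_congr n (a p)
          (\sum_(s \in [set s : composition | (weight s < n)%N])
             alpha s * p%:R ^+ weight s * mhs s p.-1).

(* Main.v *)
(* Cut the range [1, p r] into r intervals of length p.  A decreasing chain is
   then split into consecutive pieces, one per interval, so that H^(p)_{pr}(s)
   is a sum of products of block sums over p q < n < p (q + 1).  On a block put
   n = p q + i and expand p^a / (p q + i)^a p-adically in powers of p / i: this
   turns p^w(s) times the block sum into an infinite rational combination of
   the p^w(u) H_{p-1}(u).  Products of such combinations are again of this form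
   by the quasi-shuffle relations, which preserve weights. *)

Require Import Defs.
From mathcomp Require Import all_boot all_order all_algebra.
From mathcomp Require Import zify ring.
From mathcomp Require Import boolp classical_sets cardinality fsbigop.
Import Order.TTheory GRing.Theory Num.Theory.
Local Open Scope ring_scope.

Set Implicit Arguments.
Unset Strict Implicit.
Unset Printing Implicit Defensive.

(** * Nested sums and their splitting at an index *)

(** The bound is exclusive, so that consecutive blocks of indices do not overlap. The weight [f] is
    kept general because it is later shifted by multiples of p and restricted to indices prime to
    p. *)
Fixpoint nested_sum (f : nat -> nat -> rat) (s : seq nat) (n : nat) : rat :=
  if s is a :: s' then \sum_(i < n) f a i * nested_sum f s' i else 1.

(** In a decreasing tuple the indices that are at least [a] form an initial segment; [j] is its
    length. *)
Lemma nested_sum_add f s a b :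
  nested_sum f s (a + b) =
  \sum_(j < (size s).+1) nested_sum (fun c i => f c (a + i)%N) (take j s) b
                         * nested_sum f (drop j s) a.
Proof.
elim: s b => [|c s IHs] b; first by rewrite big_ord_recl big_ord0 /= mulr1 addr0.
rewrite big_ord_recl /= mul1r big_split_ord /=; congr (_ + _).
under [RHS]eq_bigr do rewrite mulr_suml.
rewrite exchange_big /=; apply: eq_bigr => i _.
by rewrite IHs mulr_sumr; apply: eq_bigr => j _; rewrite mulrA.
Qed.

(** * Sums over decreasing tuples as nested sums *)

Definition ffun_cons (T : finType) k (x : T) (u : {ffun 'I_k -> T}) :
    {ffun 'I_k.+1 -> T} :=
  [ffun i => if unlift ord0 i is Some j then u j else x].

Lemma ffun_cons0 (T : finType) k (x : T) (u : {ffun 'I_k -> T}) :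
  ffun_cons x u ord0 = x.
Proof. by rewrite ffunE unlift_none. Qed.

Lemma ffun_consS (T : finType) k (x : T) (u : {ffun 'I_k -> T}) j :
  ffun_cons x u (lift ord0 j) = u j.
Proof. by rewrite ffunE liftK. Qed.

Lemma ffun_cons_bij (T : finType) k :
  bijective (fun xu : T * {ffun 'I_k -> T} => ffun_cons xu.1 xu.2).
Proof.
exists (fun t : {ffun 'I_k.+1 -> T} => (t ord0, [ffun j => t (lift ord0 j)])).
  move=> [x u] /=; rewrite ffun_cons0; congr pair; apply/ffunP => j.
  by rewrite ffunE ffun_consS.
move=> t; apply/ffunP => i; case: (unliftP ord0 i) => [j ->|->].
  by rewrite ffun_consS ffunE.
by rewrite ffun_cons0.
Qed.

(** The positivity required by [chain] is left to the summands, which vanish below when an entry is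
    0. *)
Definition decreasing k M (t : {ffun 'I_k -> 'I_M}) : bool :=
  [forall i : 'I_k, forall j : 'I_k, (i < j) ==> (t j < t i)]%N.

Lemma decreasing_cons k M x (u : {ffun 'I_k -> 'I_M}) :
  decreasing (ffun_cons x u) = [forall j, u j < x]%N && decreasing u.
Proof.
apply/idP/andP => [/'forall_'forall_implyP xu|[/forallP ux /'forall_'forall_implyP uu]].
  split; first by apply/forallP => j; have := xu ord0 (lift ord0 j) isT;
    rewrite ffun_cons0 ffun_consS; apply.
  apply/'forall_'forall_implyP => i j ij; have := xu (lift ord0 i) (lift ord0 j).
  by rewrite !ffun_consS; apply.
apply/'forall_'forall_implyP => i j.
case: (unliftP ord0 j) => [j' ->|-> //]; rewrite ffun_consS.
case: (unliftP ord0 i) => [i' ->|->]; last by rewrite ffun_cons0.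
by rewrite ffun_consS; apply: uu.
Qed.

(** The induction lowers the bound [b] while the type ['I_M] of the entries stays fixed. *)
Lemma sum_decreasing (f : nat -> nat -> rat) s M b : (b <= M)%N ->
  \sum_(t : {ffun 'I_(size s) -> 'I_M} | decreasing t && [forall j, t j < b]%N)
     \prod_(i < size s) f (nth 0%N s i) (t i) = nested_sum f s b.
Proof.
elim: s b => [|a s IHs] b bM.
  rewrite (big_pred1 (ffun0 (card_ord 0))) ?big_ord0 //=.
  move=> t /=; have -> : t = ffun0 (card_ord 0) by apply/ffunP => -[].
  by rewrite eqxx; apply/andP; split; apply/forallP => -[].
rewrite (reindex _ (onW_bij _ (ffun_cons_bij _ _))) /=.
(* The head [x] is the largest entry, so it replaces [b] as the bound for the tail. *)
transitivity (\sum_(x < M | (x < b)%N)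
    \sum_(u : {ffun 'I_(size s) -> 'I_M} | decreasing u && [forall j, u j < x]%N)
      f a x * \prod_(i < size s) f (nth 0%N s i) (u i)).
  rewrite pair_big_dep; apply: eq_big => [[x u]|[x u] _] /=.
    rewrite decreasing_cons; apply/idP/idP.
      move=> /andP[/andP[-> ->] /forallP ub]; rewrite !andbT.
      by have := ub ord0; rewrite ffun_cons0.
    move=> /and3P[xb -> /forallP ux]; rewrite andbT; apply/andP; split.
      exact/forallP.
    apply/forallP => i; case: (unliftP ord0 i) => [j ->|->].
      by rewrite ffun_consS (ltn_trans (ux j)).
    by rewrite ffun_cons0.
  rewrite big_ord_recl ffun_cons0; congr (_ * _).
  by apply: eq_bigr => i _; rewrite ffun_consS.
rewrite (big_ord_widen _ (fun x => f a x * nested_sum f s x) bM).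
apply: eq_bigr => x xb; rewrite -mulr_sumr IHs //.
exact: leq_trans (ltnW xb) bM.
Qed.

(* recip a 0 = 0 for 0 < a, so sums over nonnegative indices are sums over
   positive ones. *)
Definition recip (a i : nat) : rat := (i%:R ^+ a)^-1.
Definition recip_coprime (p a i : nat) : rat :=
  if (p %| i)%N then 0 else recip a i.

Lemma recip0 a : (0 < a)%N -> recip a 0 = 0.
Proof. by move=> a_gt0; rewrite /recip expr0n eqn0Ngt a_gt0 invr0. Qed.

Lemma sum_decreasing_full (f : nat -> nat -> rat) s M :
  \sum_(t : {ffun 'I_(size s) -> 'I_M} | decreasing t)
     \prod_(i < size s) f (nth 0%N s i) (t i) = nested_sum f s M.
Proof.
rewrite -(sum_decreasing f s (leqnn M)); apply: eq_bigl => t.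
suff -> : [forall j, t j < M]%N by rewrite andbT.
by apply/forallP => j.
Qed.

Lemma composition_nth_gt0 (s : composition) (i : 'I_(size (val s))) :
  (0 < nth 0%N (val s) i)%N.
Proof. exact: (all_nthP 0%N (valP s)). Qed.

(** A decreasing tuple that is not a chain has a zero entry, and its product vanishes by
    [recip0]. *)
Lemma mhsE (s : composition) n : mhs s n = nested_sum recip (val s) n.+1.
Proof.
rewrite -sum_decreasing_full /mhs big_mkcond [RHS]big_mkcond /=.
apply: eq_bigr => t _; rewrite /chain -/(decreasing t) andbC.
case: (decreasing t) => //=; case: forallP => //= t0.
have /existsP[i] : [exists i, ~~ (0 < t i)%N].
  by rewrite -negb_forall; apply/forallP.
rewrite lt0n negbK => /eqP ti0; rewrite (bigD1 i) //= ti0 recip0 ?mul0r //.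
exact: composition_nth_gt0.
Qed.

(** A prime dividing the product of the entries divides one of them, and that entry contributes the
    factor 0. Zero entries are covered as well, being multiples of p. *)
Lemma mhs_coprimeE (s : composition) p n : prime p ->
  mhs_coprime s p n = nested_sum (recip_coprime p) (val s) n.+1.
Proof.
move=> p_pr; rewrite -sum_decreasing_full /mhs_coprime big_mkcond [RHS]big_mkcond /=.
apply: eq_bigr => t _; rewrite /chain -/(decreasing t) -andbA andbCA.
case: (decreasing t) => //=.
have [/forallP pt|] := boolP [forall i, ~~ (p %| t i)%N].
  have -> /= : [forall i, 0 < t i]%N.
    apply/forallP => i; move: (pt i); rewrite lt0n; apply: contraNneq => ->.
    exact: dvdn0.
  rewrite ifT; last first.
    apply: (big_ind (fun x => ~~ (p %| x)%N)) => [|x y x_p y_p|i _].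
    - by rewrite Euclid_dvd1.
    - by rewrite Euclid_dvdM // negb_or x_p.
    - exact: pt.
  by apply: eq_bigr => i _; rewrite /recip_coprime (negPf (pt i)).
rewrite negb_forall => /existsP[i]; rewrite negbK => pti.
rewrite [RHS](bigD1 i) //= /recip_coprime pti mul0r ifF //.
by rewrite (bigD1 i) //= dvdn_mulr // andbF.
Qed.

(** * Rationals integral at p and congruences modulo powers of p *)

Section PIntegral.
Variable p : nat.
Hypothesis p_pr : prime p.

(** The reduced denominator is coprime to the numerator, so it divides every [d] that clears [x].
    Unreduced fractions make closure under sums and products immediate. *)
Lemma p_integralP (x : rat) :
  reflect (exists d m : int, ~~ (p %| `|d|)%N /\ d%:~R * x = m%:~R)
          (p_integral p x).
Proof.
apply: (iffP idP) => [px|[d [m [pd dx]]]].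
  by exists (denq x), (numq x); split=> //; rewrite mulrC -numqE.
apply: contraNN pd => px; apply: dvdn_trans px _.
have xE : x * (denq x)%:~R = (numq x)%:~R by rewrite -numqE.
have /eqP : d * numq x = m * denq x.
  by apply: (@intr_inj rat); rewrite !rmorphM /= -dx -xE mulrA.
move=> /eqP/(congr1 absz); rewrite !abszM => dm.
rewrite -(@Gauss_dvdl _ _ `|numq x|); last by rewrite coprime_sym coprime_num_den.
by rewrite dm dvdn_mull.
Qed.

Lemma p_integral_int (m : int) : p_integral p m%:~R.
Proof.
apply/p_integralP; exists 1, m; split; last by rewrite mul1r.
by rewrite Euclid_dvd1.
Qed.

Lemma p_integralD x y : p_integral p x -> p_integral p y -> p_integral p (x + y).
Proof.
move=> /p_integralP[d [m [pd dx]]] /p_integralP[e [n [pe ey]]].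
apply/p_integralP; exists (d * e), (e * m + d * n); split.
  by rewrite abszM Euclid_dvdM // negb_or pd.
by rewrite rmorphD !rmorphM /= -dx -ey; ring.
Qed.

Lemma p_integralM x y : p_integral p x -> p_integral p y -> p_integral p (x * y).
Proof.
move=> /p_integralP[d [m [pd dx]]] /p_integralP[e [n [pe ey]]].
apply/p_integralP; exists (d * e), (m * n); split.
  by rewrite abszM Euclid_dvdM // negb_or pd.
by rewrite !rmorphM /= -dx -ey; ring.
Qed.

Lemma p_integral_nat (m : nat) : p_integral p m%:R.
Proof. exact: (p_integral_int m). Qed.

Lemma p_integralN x : p_integral p x -> p_integral p (- x).
Proof. by move=> px; rewrite -mulN1r p_integralM // (p_integral_int (-1)). Qed.

Lemma p_integralX x n : p_integral p x -> p_integral p (x ^+ n).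
Proof.
by move=> px; elim: n => [|n IHn]; rewrite ?(p_integral_nat 1) // exprS p_integralM.
Qed.

Lemma p_integral_sum (I : Type) (r : seq I) (P : pred I) F :
  (forall i, P i -> p_integral p (F i)) -> p_integral p (\sum_(i <- r | P i) F i).
Proof.
move=> pF; apply: (big_ind (p_integral p)) => //; first exact: (p_integral_nat 0).
exact: p_integralD.
Qed.

Lemma p_integralV (i : nat) : ~~ (p %| i)%N -> p_integral p i%:R^-1.
Proof.
move=> pi; apply/p_integralP; exists i, 1; split=> //=.
by rewrite divff // pnatr_eq0; apply: contraNneq pi => ->.
Qed.

(** Congruence modulo p^n Z_(p) on all of Q; integrality of [x] and [y] is a separate condition,
    which passes from one side to the other. *)
Definition eqmod n (x y : rat) : Prop :=
  exists2 z, p_integral p z & x - y = p%:R ^+ n * z.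

Lemma eqmod_refl n x : eqmod n x x.
Proof. by exists 0; rewrite ?subrr ?mulr0 ?(p_integral_nat 0). Qed.

Lemma eqmod_trans n x y z : eqmod n x y -> eqmod n y z -> eqmod n x z.
Proof.
move=> [u pu xy] [v pv yz]; exists (u + v); first exact: p_integralD.
by rewrite mulrDr -xy -yz; ring.
Qed.

Lemma eqmodD n x y x' y' : eqmod n x y -> eqmod n x' y' -> eqmod n (x + x') (y + y').
Proof.
move=> [u pu xy] [v pv xy']; exists (u + v); first exact: p_integralD.
by rewrite mulrDr -xy -xy'; ring.
Qed.

Lemma eqmod_sum n (I : Type) (r : seq I) (P : pred I) F G :
  (forall i, P i -> eqmod n (F i) (G i)) ->
  eqmod n (\sum_(i <- r | P i) F i) (\sum_(i <- r | P i) G i).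
Proof.
move=> FG; apply: (big_ind2 (eqmod n)) => //; first exact: eqmod_refl.
by move=> *; apply: eqmodD.
Qed.

Lemma eqmod_p_integral n x y : eqmod n x y -> p_integral p y -> p_integral p x.
Proof.
move=> [z pz xy] py; rewrite -(subrK y x) xy p_integralD // p_integralM //.
exact/p_integralX/p_integral_nat.
Qed.

(** Write x x' - y y' = x (x' - y') + (x - y) y', where [x] inherits integrality from [y]. *)
Lemma eqmodM n x y x' y' : eqmod n x y -> eqmod n x' y' ->
  p_integral p y -> p_integral p y' -> eqmod n (x * x') (y * y').
Proof.
move=> xy xy' py py'; have px := eqmod_p_integral xy py.
case: xy xy' => [u pu xy] [v pv xy'].
exists (x * v + u * y'); first by apply: p_integralD; apply: p_integralM.
have -> : p%:R ^+ n * (x * v + u * y')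
  = x * (p%:R ^+ n * v) + (p%:R ^+ n * u) * y' by ring.
by rewrite -xy -xy'; ring.
Qed.

End PIntegral.

(** * Truncated series in p and their products *)

Definition cauchy (x y : nat -> rat) (t : nat) : rat :=
  \sum_(v < t.+1) x v * y (t - v)%N.

(** A series in p cut off below p^n, whose coefficients [x w] may themselves vary with p. *)
Definition expansion (x : nat -> rat) (n p : nat) : rat :=
  \sum_(w < n) p%:R ^+ w * x w.

Lemma expansion_cauchy x y n p :
  expansion (cauchy x y) n p =
  \sum_(v < n) \sum_(w < n | (v + w < n)%N) p%:R ^+ v * x v * (p%:R ^+ w * y w).
Proof.
rewrite /expansion /cauchy.
transitivity (\sum_(t < n) \sum_(v < n | (v <= t)%N) p%:R ^+ t * (x v * y (t - v)%N)).
  apply: eq_bigr => t _; rewrite mulr_sumr.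
  rewrite (big_ord_widen n (fun v => p%:R ^+ t * (x v * y (t - v)%N))) //.
rewrite (exchange_big_dep predT) //=; apply: eq_bigr => v _.
pose F w := p%:R ^+ v * x v * (p%:R ^+ w * y w).
transitivity (\sum_(0 <= w < n - v) F w).
  transitivity (\sum_(v <= t < n) p%:R ^+ t * (x v * y (t - v)%N)).
    by rewrite (@big_nat_widenl _ _ _ v 0%N) // big_mkord; apply: eq_bigl => t.
  rewrite -{1}[nat_of_ord v]add0n big_addn; apply: eq_bigr => w _.
  by rewrite addnK exprD /F; ring.
rewrite big_mkord (big_ord_widen n F) ?leq_subr //; apply: eq_bigl => w.
by rewrite ltn_subRL.
Qed.

Lemma p_integral_expansion p x n : prime p ->
  (forall w, (w < n)%N -> p_integral p (x w)) -> p_integral p (expansion x n p).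
Proof.
move=> p_pr px; apply: p_integral_sum => // w _; apply: p_integralM => //.
  exact/p_integralX/p_integral_nat.
exact: px.
Qed.

(** The products absent from the right-hand side have degree v + w at least n, hence are divisible
    by p^n. *)
Lemma expansionM p x y n : prime p ->
  (forall w, (w < n)%N -> p_integral p (x w)) ->
  (forall w, (w < n)%N -> p_integral p (y w)) ->
  eqmod p n (expansion x n p * expansion y n p) (expansion (cauchy x y) n p).
Proof.
move=> p_pr px py; rewrite expansion_cauchy /expansion mulr_suml.
apply: eqmod_sum => // v _.
rewrite mulr_sumr big_mkcond [X in eqmod _ _ _ X]big_mkcond /=.
apply: eqmod_sum => // w _; case: ltnP => vw; first exact: eqmod_refl.
exists (p%:R ^+ (v + w - n) * x v * y w).
  apply: p_integralM; rewrite ?py //; apply: p_integralM; rewrite ?px //.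
  exact/p_integralX/p_integral_nat.
by rewrite subr0 !mulrA -exprD subnKC // exprD; ring.
Qed.

(** * Rational combinations of harmonic sums of a fixed weight *)

(* One combination serves all m: the bound m varies under an outer summation
   when compositions are extended, and only at the end is it set to p. *)
Definition mhs_span (w : nat) (g : nat -> rat) : Prop :=
  exists2 l : seq (rat * composition), {in l, forall x, weight x.2 = w} &
    forall m, g m = \sum_(x <- l) x.1 * nested_sum recip (val x.2) m.

Lemma eq_mhs_span w g h : g =1 h -> mhs_span w g -> mhs_span w h.
Proof. by move=> gh [l lw lE]; exists l => // m; rewrite -gh. Qed.

Lemma mhs_span0 w : mhs_span w (fun=> 0).
Proof. by exists [::] => // m; rewrite big_nil. Qed.

Lemma mhs_spanD w g h : mhs_span w g -> mhs_span w h ->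
  mhs_span w (fun m => g m + h m).
Proof.
move=> [l lw lE] [k kw kE]; exists (l ++ k) => [x|m]; last by rewrite big_cat lE kE.
by rewrite mem_cat => /orP[/lw|/kw].
Qed.

Lemma mhs_spanZ w c g : mhs_span w g -> mhs_span w (fun m => c * g m).
Proof.
move=> [l lw lE]; exists [seq (c * x.1, x.2) | x <- l] => [_ /mapP[x /lw xw ->] //|m].
by rewrite big_map lE mulr_sumr; apply: eq_bigr => x _; rewrite mulrA.
Qed.

Lemma mhs_span_sum w (I : eqType) (r : seq I) (g : I -> nat -> rat) :
  {in r, forall i, mhs_span w (g i)} -> mhs_span w (fun m => \sum_(i <- r) g i m).
Proof.
elim: r => [|i r IHr] gw.
  by apply: eq_mhs_span (mhs_span0 w) => m; rewrite big_nil.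
apply: eq_mhs_span (mhs_spanD (gw i (mem_head i r)) (IHr _)) => [m|j jr].
  by rewrite big_cons.
by apply: gw; rewrite inE jr orbT.
Qed.

Lemma mhs_span_nested_sum s : all (leq 1) s ->
  mhs_span (sumn s) (nested_sum recip s).
Proof.
move=> s_gt0; exists [:: (1, exist _ s s_gt0)] => [x|m].
  by rewrite inE => /eqP ->.
by rewrite big_seq1 mul1r.
Qed.

(** One combination represents [g i] for every i, so [a] can be prepended to each of its
    compositions. *)
Lemma mhs_span_cons a w g : (0 < a)%N -> mhs_span w g ->
  mhs_span (a + w) (fun m => \sum_(i < m) recip a i * g i).
Proof.
move=> a_gt0 [l lw lE].
have s_gt0 (s : composition) : all (leq 1) (a :: val s) by rewrite /= a_gt0 (valP s).
pose cons_comp (s : composition) : composition :=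
  exist (fun u => is_true (all (leq 1) u)) _ (s_gt0 s).
exists [seq (x.1, cons_comp x.2) | x <- l].
  by move=> _ /mapP[x /lw xw ->]; rewrite -xw.
move=> m; rewrite big_map /=; under [RHS]eq_bigr do rewrite mulr_sumr.
rewrite exchange_big; apply: eq_bigr => i _ /=.
by rewrite lE mulr_sumr; apply: eq_bigr => x _; ring.
Qed.

(** Pairs of indices are sorted by which one is larger, with the diagonal apart. *)
Lemma mul_sum_ord (f g : nat -> rat) m :
  (\sum_(i < m) f i) * (\sum_(i < m) g i) =
  \sum_(i < m) f i * (\sum_(j < i) g j) + \sum_(i < m) g i * (\sum_(j < i) f j)
  + \sum_(i < m) f i * g i.
Proof.
elim: m => [|m IHm]; first by rewrite !big_ord0 mul0r !addr0.
by rewrite !big_ord_recr /= mulrDl !mulrDr IHm; ring.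
Qed.

(** The quasi-shuffle product, by a double induction on the two compositions. *)
Lemma mhs_span_nested_sumM s t : all (leq 1) s -> all (leq 1) t ->
  mhs_span (sumn s + sumn t) (fun m => nested_sum recip s m * nested_sum recip t m).
Proof.
elim: s t => [|a s IHs] t.
  move=> _ /mhs_span_nested_sum; apply: eq_mhs_span => m.
  by rewrite mul1r.
move=> as_gt0; have /andP[a_gt0 s_gt0] := as_gt0.
elim: t => [_|b t IHt bt_gt0].
  rewrite addn0; apply: eq_mhs_span (mhs_span_nested_sum as_gt0) => m.
  by rewrite mulr1.
have /andP[b_gt0 t_gt0] := bt_gt0.
(* The largest index comes from the first factor only, from the second only, or from both; in the
   last case the parts merge into [a + b]. *)
have h1 := mhs_span_cons a_gt0 (IHs _ s_gt0 bt_gt0).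
have h2 := mhs_span_cons b_gt0 (IHt t_gt0).
have ab_gt0 : (0 < a + b)%N by rewrite addn_gt0 a_gt0.
have h3 := mhs_span_cons ab_gt0 (IHs _ s_gt0 t_gt0).
have e1 : (a + (sumn s + sumn (b :: t)) = sumn (a :: s) + sumn (b :: t))%N.
  by rewrite /=; lia.
have e2 : (b + (sumn (a :: s) + sumn t) = sumn (a :: s) + sumn (b :: t))%N.
  by rewrite /=; lia.
have e3 : (a + b + (sumn s + sumn t) = sumn (a :: s) + sumn (b :: t))%N.
  by rewrite /=; lia.
rewrite e1 in h1; rewrite e2 in h2; rewrite e3 in h3.
apply: eq_mhs_span (mhs_spanD (mhs_spanD h1 h2) h3) => m /=.
rewrite (mul_sum_ord (fun i => recip a i * nested_sum recip s i)
                     (fun i => recip b i * nested_sum recip t i)); congr (_ + _ + _); 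
  apply: eq_bigr => i _ /=; rewrite /recip ?exprD ?invfM; ring.
Qed.

Lemma mhs_spanM v w g h : mhs_span v g -> mhs_span w h ->
  mhs_span (v + w) (fun m => g m * h m).
Proof.
move=> [l lv lE] [k kw kE].
suff : mhs_span (v + w) (fun m => \sum_(x <- l) \sum_(y <- k)
    x.1 * nested_sum recip (val x.2) m * (y.1 * nested_sum recip (val y.2) m)).
  apply: eq_mhs_span => m; rewrite lE kE mulr_suml.
  by apply: eq_bigr => x _; rewrite mulr_sumr.
apply: mhs_span_sum => x /lv <-; apply: mhs_span_sum => y /kw <-.
apply: eq_mhs_span (mhs_spanZ (x.1 * y.1)
  (mhs_span_nested_sumM (valP x.2) (valP y.2))) => m.
by rewrite /=; ring.
Qed.

Lemma mhs_span_cauchy (G H : nat -> nat -> rat) :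
  (forall w, mhs_span w (G w)) -> (forall w, mhs_span w (H w)) ->
  forall w, mhs_span w (fun m => cauchy (G^~ m) (H^~ m) w).
Proof.
move=> Gw Hw w; apply: mhs_span_sum => v _.
by rewrite -[w in mhs_span w _](subnKC (leq_ord v)); apply: mhs_spanM.
Qed.

(** * Integrality of the coefficients for large p *)

Lemma p_integral_recip p a i : prime p -> (i < p)%N -> p_integral p (recip a i).
Proof.
move=> p_pr i_p; rewrite /recip -exprVn; apply: p_integralX => //.
(* At i = 0 the inverse takes the default value 0. *)
case: (posnP i) => [->|i_gt0]; first by rewrite invr0 (p_integral_nat p_pr 0).
by apply: p_integralV; rewrite // gtnNdvd.
Qed.

Lemma p_integral_nested_sum p s m : prime p -> (m <= p)%N ->
  p_integral p (nested_sum recip s m).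
Proof.
move=> p_pr; elim: s m => [|a s IHs] m mp; first exact: (p_integral_nat p_pr 1).
apply: p_integral_sum => // i _; have ip := leq_trans (ltn_ord i) mp.
by apply: p_integralM; [|exact: p_integral_recip|exact/IHs/ltnW].
Qed.

(** A prime exceeding the finitely many denominators in the combination divides none of them, and
    the harmonic sums only involve indices below p. *)
Lemma mhs_span_p_integral w g : mhs_span w g ->
  exists N, forall p, prime p -> (N <= p)%N ->
    forall m, (m <= p)%N -> p_integral p (g m).
Proof.
move=> [l _ lE].
have [N NP] : exists N, forall p, prime p -> (N <= p)%N ->
    forall x, x \in l -> p_integral p x.1.
  elim: l {lE} => [|x l [N NP]]; first by exists 0%N.
  exists (maxn N `|denq x.1|.+1) => p p_pr; rewrite geq_max => /andP[Np xp] y.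
  rewrite inE => /orP[/eqP ->|]; last exact: NP.
  by rewrite /p_integral gtnNdvd // absz_gt0 denq_neq0.
exists N => p p_pr Np m mp; rewrite lE big_seq; apply: p_integral_sum => // x xl.
apply: p_integralM => //; first exact: NP xl.
exact: p_integral_nested_sum.
Qed.

(** The threshold depends on [n]: the whole series may involve infinitely many denominators. *)
Lemma mhs_series_p_integral (G : nat -> nat -> rat) n :
  (forall w, mhs_span w (G w)) ->
  exists N, forall p, prime p -> (N <= p)%N ->
    forall m w, (m <= p)%N -> (w < n)%N -> p_integral p (G w m).
Proof.
move=> Gw; elim: n => [|n [N NP]]; first by exists 0%N.
have [M MP] := mhs_span_p_integral (Gw n).
exists (maxn N M) => p p_pr; rewrite geq_max => /andP[Np Mp] m w mp.
by rewrite ltnS leq_eqVlt => /orP[/eqP ->|wn]; [exact: MP|exact: NP].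
Qed.

(** * Expansion of reciprocals and of block sums *)

Lemma eq_expansion x y n p : x =1 y -> expansion x n p = expansion y n p.
Proof. by move=> xy; apply: eq_bigr => w _; rewrite xy. Qed.

(* With z = - p q / i, this truncates p / (p q + i) = (p / i) (1 + z + z^2 + ...). *)
Lemma recip_expansion1 p q i n : prime p -> ~~ (p %| i)%N ->
  eqmod p n (p%:R * recip 1 (p * q + i))
    (expansion (fun v => (if v is u.+1 then (- q%:R) ^+ u else 0) * recip v i) n p).
Proof.
move=> p_pr pi; set R := recip 1 _; set y : rat := i%:R^-1.
have i_neq0 : i%:R != 0 :> rat by rewrite pnatr_eq0; apply: contraNneq pi => ->.
have pqi : ~~ (p %| p * q + i)%N by rewrite dvdn_addr ?dvdn_mulr.
have pqi_neq0 : p%:R * q%:R + i%:R != 0 :> rat.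
  by rewrite -natrM -natrD pnatr_eq0; apply: contraNneq pqi => ->.
have pR : p_integral p R by rewrite /R /recip expr1 p_integralV.
have py : p_integral p y by exact: p_integralV.
(* Each use of this equation peels off one term of the geometric series. *)
have RE : R = y - p%:R * (q%:R * y) * R.
  by rewrite /R /recip /y expr1 natrD natrM; field; rewrite pqi_neq0.
case: n => [|n].
  rewrite /expansion big_ord0; exists (p%:R * R); last by rewrite subr0 mul1r.
  by rewrite p_integralM // p_integral_nat.
(* The exact remainder after the terms of degree at most n, divided by p^(n+1). *)
exists ((- q%:R * y) ^+ n * R).
  apply: p_integralM => //; apply/p_integralX/p_integralM => //.
  exact/p_integralN/p_integral_nat.
elim: n => [|n IHn].
  by rewrite /expansion big_ord_recl big_ord0 expr0 mul0r; ring.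
rewrite /expansion big_ord_recr /= -/(expansion _ _ _) opprD addrA IHn.
rewrite {1}RE /recip -exprVn -/y; set A := p%:R; rewrite !exprMn !exprS.
by ring.
Qed.

(** The case of exponent 1 is multiplied with itself [a] times. The coefficients [C] depend on [q]
    and [a] only. The vanishing of [C 0] for positive [a] ensures that only positive parts are
    prepended later. *)
Lemma recip_expansion q a : exists C : nat -> rat,
  [/\ forall v, C v \is a Num.int, (0 < a)%N -> C 0%N = 0 &
    forall p n i, prime p -> ~~ (p %| i)%N ->
      eqmod p n (p%:R ^+ a * recip a (p * q + i))
                (expansion (fun v => C v * recip v i) n p)].
Proof.
elim: a => [|a [C [C_int _ CP]]].
  exists (fun v => (v == 0%N)%:R); split=> [v||p n i p_pr _] //.
  rewrite mul1r /recip expr0 invr1; case: n => [|n].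
    rewrite /expansion big_ord0; exists 1; first exact: (p_integral_nat p_pr 1).
    by rewrite subr0 mulr1.
  rewrite /expansion big_ord_recl big1 => [|j _]; last by rewrite mul0r mulr0.
  by rewrite expr0 invr1 !mulr1 addr0; apply: eqmod_refl.
pose C1 (v : nat) : rat := if v is u.+1 then (- q%:R) ^+ u else 0.
have C1_int v : C1 v \is a Num.int.
  by case: v => [|v]; rewrite ?rpred0 // rpredX // rpredN natr_int.
exists (cauchy C C1); split=> [v|_|p n i p_pr pi].
- by apply: rpred_sum => u _; rewrite rpredM.
- by rewrite /cauchy big_ord_recl big_ord0 mulr0 addr0.
have -> : p%:R ^+ a.+1 * recip a.+1 (p * q + i) =
    (p%:R ^+ a * recip a (p * q + i)) * (p%:R * recip 1 (p * q + i)).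
  by rewrite /recip !exprSr expr0 mul1r invfM; ring.
have int_C (D : nat -> rat) v : D v \is a Num.int -> p_integral p (D v * recip v i).
  move=> /intrP[m ->]; apply: p_integralM => //; first exact: p_integral_int.
  by rewrite /recip -exprVn; apply/p_integralX/p_integralV.
have := eqmodM p_pr (CP p n i p_pr pi) (recip_expansion1 q n p_pr pi).
rewrite -/C1 => /(_ _ _)/eqmod_trans; apply => //.
- by apply: p_integral_expansion => // w _; apply: int_C.
- by apply: p_integral_expansion => // w _; apply: (int_C C1).
rewrite [X in eqmod _ _ _ X](_ : _ = expansion (cauchy (fun v => C v * recip v i)
   (fun v => C1 v * recip v i)) n p).
  by apply: expansionM => // w _; [apply: int_C|apply: (int_C C1)].
apply: eq_expansion => t; rewrite /cauchy mulr_suml; apply: eq_bigr => v _.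
(* In degree t the dependence on i is always i^-t, so it factors out of the Cauchy product. *)
have -> : recip t i = recip v i * recip (t - v) i.
  by rewrite /recip -invfM -exprD subnKC // leq_ord.
by ring.
Qed.

(** The leading factor is expanded by [recip_expansion], and the inner sum up to its index i by
    induction; this is why the congruence is claimed for all m up to p at once. *)
Lemma block_expansion q s : all (leq 1) s ->
  exists2 G : nat -> nat -> rat, forall w, mhs_span w (G w) &
    forall n, exists N, forall p, prime p -> (N <= p)%N -> forall m, (m <= p)%N ->
      eqmod p n (p%:R ^+ sumn s *
                  nested_sum (fun a i => recip_coprime p a (p * q + i)) s m)
                (expansion (G^~ m) n p).
Proof.
elim: s => [_|a s IHs /andP[a_gt0 /IHs[G Gw GP]]].
  exists (fun w _ => (w == 0%N)%:R) => [[|w]|n].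
  - exact: (@mhs_span_nested_sum [::]).
  - exact: mhs_span0.
  exists 0%N => p p_pr _ m _ /=; rewrite mul1r; case: n => [|n].
    rewrite /expansion big_ord0; exists 1; first exact: (p_integral_nat p_pr 1).
    by rewrite subr0 mulr1.
  rewrite /expansion big_ord_recl big1 => [|j _]; last by rewrite mulr0.
  by rewrite mulr1 addr0; apply: eqmod_refl.
have [C [C_int C0 CP]] := recip_expansion q a; move/(_ a_gt0) in C0.
exists (fun t m => \sum_(i < m) cauchy (fun v => C v * recip v i) (G^~ i) t).
  move=> t; rewrite /cauchy.
  (* With the sum over i innermost, each term prepends a part v to a combination of weight t - v. *)
  suff : mhs_span t (fun m =>
      \sum_(v < t.+1) C v * \sum_(i < m) recip v i * G (t - v)%N i).
    apply: eq_mhs_span => m; rewrite exchange_big; apply: eq_bigr => v _ /=.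
    by rewrite mulr_sumr; apply: eq_bigr => i _; rewrite mulrA.
  apply: mhs_span_sum => v _; case: (posnP v) => [->|v_gt0].
    by apply: eq_mhs_span (mhs_span0 t) => m; rewrite C0 mul0r.
  apply: mhs_spanZ; rewrite -[t in mhs_span t _](subnKC (leq_ord v)).
  exact: mhs_span_cons.
move=> n; have [N NP] := GP n; have [M MP] := mhs_series_p_integral n Gw.
exists (maxn N M) => p p_pr; rewrite geq_max => /andP[Np Mp] m mp.
rewrite [X in eqmod _ _ _ X](_ : _ = \sum_(i < m)
    expansion (cauchy (fun v => C v * recip v i) (G^~ i)) n p); last first.
  by rewrite /expansion exchange_big; apply: eq_bigr => w _; rewrite mulr_sumr.
rewrite /= mulr_sumr; apply: eqmod_sum => // i _.
have ip := leq_trans (ltn_ord i) mp.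
(* At i = 0 the left side vanishes because p divides p q; on the right [C0] kills v = 0 and [recip0]
   kills v > 0. *)
case: (posnP i) => [i0|i_gt0].
  rewrite i0 /recip_coprime addn0 dvdn_mulr // mul0r mulr0.
  rewrite /expansion big1; first exact: eqmod_refl.
  move=> w _; rewrite /cauchy big1 ?mulr0 // => v _.
  by case: (posnP v) => [->|v_gt0]; [rewrite C0 !mul0r|rewrite recip0 ?mulr0 ?mul0r].
have pi : ~~ (p %| i)%N by rewrite gtnNdvd.
rewrite /recip_coprime dvdn_addr ?dvdn_mulr // (negPf pi) exprD mulrACA.
have int_C v : p_integral p (C v * recip v i).
  have /intrP[c ->] := C_int v; apply: p_integralM => //; first exact: p_integral_int.
  exact: p_integral_recip.
have int_G w : (w < n)%N -> p_integral p (G w i) by apply: MP => //; apply: ltnW.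
apply: eqmod_trans (expansionM p_pr (fun w _ => int_C w) int_G) => //.
apply: eqmodM => //; [exact: CP|exact/NP/ltnW| |]; exact: p_integral_expansion.
Qed.

(** * Rational families with a harmonic expansion *)

(** A rational form of asymptotic representability: evaluating [G w] at the exclusive bound p gives
    sums H_{p-1} of weight w. *)
Definition has_mhs_expansion (a : nat -> rat) : Prop :=
  exists2 G : nat -> nat -> rat, forall w, mhs_span w (G w) &
    forall n, exists N, forall p, prime p -> (N <= p)%N ->
      eqmod p n (a p) (expansion (G^~ p) n p).

Lemma has_mhs_expansion_eq a b : (forall p, prime p -> a p = b p) ->
  has_mhs_expansion a -> has_mhs_expansion b.
Proof.
move=> ab [G Gw GP]; exists G => // n; have [N NP] := GP n.
by exists N => p p_pr Np; rewrite -ab //; apply: NP.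
Qed.

Lemma has_mhs_expansion0 : has_mhs_expansion (fun=> 0).
Proof.
exists (fun _ _ => 0) => [w|n]; first exact: mhs_span0.
exists 0%N => p p_pr _; rewrite /expansion big1 => [|w _]; last by rewrite mulr0.
exact: eqmod_refl.
Qed.

Lemma has_mhs_expansion1 : has_mhs_expansion (fun=> 1).
Proof.
have [G Gw GP] := @block_expansion 0 [::] isT.
exists G => // n; have [N NP] := GP n; exists N => p p_pr Np.
by have := NP p p_pr Np p (leqnn p); rewrite /= mul1r.
Qed.

Lemma has_mhs_expansionD a b : has_mhs_expansion a -> has_mhs_expansion b ->
  has_mhs_expansion (fun p => a p + b p).
Proof.
move=> [G Gw GP] [H Hw HP]; exists (fun w m => G w m + H w m) => [w|n].
  exact: mhs_spanD.
have [N NP] := GP n; have [M MP] := HP n.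
exists (maxn N M) => p p_pr; rewrite geq_max => /andP[Np Mp].
rewrite /expansion; under eq_bigr do rewrite mulrDr.
by rewrite big_split; apply: eqmodD; [|apply: NP|apply: MP].
Qed.

Lemma has_mhs_expansion_sum (I : Type) (r : seq I) (a : I -> nat -> rat) :
  (forall i, has_mhs_expansion (a i)) ->
  has_mhs_expansion (fun p => \sum_(i <- r) a i p).
Proof.
move=> ha; elim: r => [|i r IHr].
  by apply: has_mhs_expansion_eq has_mhs_expansion0 => p _; rewrite big_nil.
by apply: has_mhs_expansion_eq (has_mhs_expansionD (ha i) IHr) => p _; rewrite big_cons.
Qed.

(** Multiplying the congruences requires integral truncations, whence the two additional
    thresholds. *)
Lemma has_mhs_expansionM a b : has_mhs_expansion a -> has_mhs_expansion b ->
  has_mhs_expansion (fun p => a p * b p).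
Proof.
move=> [G Gw GP] [H Hw HP].
exists (fun w m => cauchy (G^~ m) (H^~ m) w); first exact: mhs_span_cauchy.
move=> n; have [N NP] := GP n; have [M MP] := HP n.
have [N' NP'] := mhs_series_p_integral n Gw.
have [M' MP'] := mhs_series_p_integral n Hw.
exists (maxn (maxn N M) (maxn N' M')) => p p_pr.
rewrite !geq_max => /andP[/andP[Np Mp] /andP[Np' Mp']].
have int_G w : (w < n)%N -> p_integral p (G w p) by apply: NP'.
have int_H w : (w < n)%N -> p_integral p (H w p) by apply: MP'.
apply: eqmod_trans (expansionM p_pr int_G int_H) => //.
by apply: eqmodM => //; [exact: NP|exact: MP| |]; apply: p_integral_expansion.
Qed.

(** Induction on the number of blocks: the top block, with q = r, carries an initial piece of [s],
    and the power of p splits according to the weights of the two pieces. *)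
Lemma has_mhs_expansion_coprime r s : all (leq 1) s ->
  has_mhs_expansion
    (fun p => p%:R ^+ sumn s * nested_sum (recip_coprime p) s (p * r)).
Proof.
elim: r s => [|r IHr] s s_gt0.
  case: s s_gt0 => [|a s] _.
    by apply: has_mhs_expansion_eq has_mhs_expansion1 => p _; rewrite mul1r.
  apply: has_mhs_expansion_eq has_mhs_expansion0 => p _.
  by rewrite muln0 /= big_ord0 mulr0.
have : has_mhs_expansion (fun p => \sum_(j < (size s).+1)
   (p%:R ^+ sumn (take j s) *
      nested_sum (fun a i => recip_coprime p a (p * r + i)) (take j s) p) *
   (p%:R ^+ sumn (drop j s) * nested_sum (recip_coprime p) (drop j s) (p * r))).
  apply: has_mhs_expansion_sum => j.
  move: s_gt0; rewrite -{1}(cat_take_drop j s) all_cat => /andP[take_gt0 drop_gt0].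
  apply: has_mhs_expansionM; last exact: IHr.
  have [G Gw GP] := @block_expansion r _ take_gt0.
  exists G => // n; have [N NP] := GP n; exists N => p p_pr Np.
  exact: NP.
apply: has_mhs_expansion_eq => p _.
rewrite mulnS addnC nested_sum_add mulr_sumr; apply: eq_bigr => j _.
by rewrite mulrACA -exprD -sumn_cat cat_take_drop.
Qed.

(** * From rational to p-adic congruences *)

Section PadicCongr.
Variable p : nat.
Hypothesis p_pr : prime p.

(** An integer prime to p is a unit in every residue ring. *)
Lemma padic_int_mulI (d : int) (x y : padic_int p) : ~~ (p %| `|d|)%N ->
  d%:~R * x = d%:~R * y -> x = y.
Proof.
move=> pd xy; apply: padic_int_ext => n.
have ud : (d%:~R : 'Z_(p ^ n.+1)) \is a GRing.unit.
  have unat : ((`|d|%N)%:R : 'Z_(p ^ n.+1)) \is a GRing.unit.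
    by rewrite unitZpE ?expn_gt1 ?prime_gt1 // coprime_pexpl // prime_coprime.
  by case: d pd unat {xy} => m; rewrite ?NegzE ?mulrNz ?unitrN -?pmulrn.
have := congr1 (fun z => residue z n) xy.
by rewrite !residueM residue_int; apply: mulrI.
Qed.

(** This allows any fraction for [x], so that identities can be checked in integers once
    denominators are cleared. *)
Lemma padic_of_ratE x (d m : int) : p_integral p x ->
  d%:~R * x = m%:~R -> d%:~R * padic_of_rat p x = m%:~R.
Proof.
move=> px dx; apply: (padic_int_mulI px); rewrite mulrCA padic_of_ratP //.
rewrite -!rmorphM; congr (_%:~R); apply: (@intr_inj rat).
by rewrite !rmorphM /= -dx numqE; ring.
Qed.

Lemma padic_of_rat_congr n x y : p_integral p y -> eqmod p n x y ->
  padic_congr n (padic_of_rat p x) y.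
Proof.
move=> py xy; have px := eqmod_p_integral p_pr xy py.
split=> //; case: xy => z pz xy; exists (padic_of_rat p z).
(* A common denominator of the two sides and the quotient, still prime to p. *)
pose d : int := denq x * denq y * denq z.
have pd : ~~ (p %| `|d|)%N.
  rewrite !abszM !Euclid_dvdM // !negb_or.
  by apply/andP; split=> //; apply/andP.
apply: (padic_int_mulI pd).
have dxE := @padic_of_ratE x d (numq x * denq y * denq z) px.
have dyE := @padic_of_ratE y d (denq x * numq y * denq z) py.
have dzE := @padic_of_ratE z d (denq x * denq y * numq z) pz.
rewrite mulrBr mulrCA dxE ?dyE ?dzE; try by rewrite !rmorphM /= !numqE; ring.
rewrite -[p%:R]/((p : int)%:~R) -rmorphXn -rmorphB -rmorphM; congr (_%:~R).
apply: (@intr_inj rat); rewrite rmorphB !rmorphM rmorphXn /= !numqE.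
transitivity ((denq x)%:~R * (denq y)%:~R * (denq z)%:~R * (x - y)); first by ring.
by rewrite xy; ring.
Qed.

End PadicCongr.

(** * Reading off the coefficients *)

(** A composition can occur only in the list indexed by its own weight, so grouping equal entries
    there collects its full coefficient. *)
Lemma mhs_series_sum (l : nat -> seq (rat * composition)) n p :
  (forall w, {in l w, forall x, weight x.2 = w}) ->
  \sum_(s \in [set s : composition | (weight s < n)%N])
     (\sum_(x <- l (weight s) | x.2 == s) x.1) * p%:R ^+ weight s
        * nested_sum recip (val s) p =
  expansion (fun w => \sum_(x <- l w) x.1 * nested_sum recip (val x.2) p) n p.
Proof.
move=> lw; have /finite_seqP[L0 LE0] := finite_weight_lt n.
pose L := undup L0.
have LP s : (s \in L) = (weight s < n)%N.
  have e : (weight s < n)%N = (s \in L0) :> Prop := congr1 (fun A => A s) LE0.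
  by rewrite mem_undup; apply/idP/idP; rewrite e.
rewrite LE0 (_ : [set` L0]%classic = [set` L]%classic); last first.
  by apply/seteqP; split=> s /=; rewrite mem_undup.
rewrite -fsbig_seq ?undup_uniq //=.
(* A sum over the single value w = [weight s] is inserted so that the summations can be
   exchanged. *)
transitivity (\sum_(s <- L) \sum_(w < n | w == weight s :> nat)
   \sum_(x <- l w | x.2 == s) p%:R ^+ w * (x.1 * nested_sum recip (val x.2) p)).
  rewrite !big_seq; apply: eq_bigr => s; rewrite LP => sn.
  rewrite (big_pred1 (Ordinal sn)) //= !mulr_suml.
  by apply: eq_bigr => x /eqP ->; ring.
rewrite (exchange_big_dep predT) //=; apply: eq_bigr => w _.
rewrite mulr_sumr (exchange_big_dep predT) //= [LHS]big_seq [RHS]big_seq.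
apply: eq_bigr => x xl; have xw := lw _ _ xl.
(* Exactly one s survives: [x.2] has weight w < n and [L] is free of repetitions. *)
rewrite -big_filter (_ : [seq s <- L | _] = [:: x.2]) ?big_seq1 //.
rewrite (eq_filter (a2 := pred1 x.2)).
  by rewrite filter_pred1_uniq ?undup_uniq // LP xw.
move=> s /=; rewrite andbC eq_sym; case: eqP => //= ->.
by rewrite xw eqxx.
Qed.

Lemma has_mhs_expansion_representable a : has_mhs_expansion a ->
  asymptotically_representable (fun p => padic_of_rat p (a p)).
Proof.
move=> [G Gw GP].
(* Choosing all lists simultaneously makes the coefficients independent of both n and p. *)
have /choice[l lP] w : exists l : seq (rat * composition),
    {in l, forall x, weight x.2 = w} /\
    forall m, G w m = \sum_(x <- l) x.1 * nested_sum recip (val x.2) m.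
  by have [l] := Gw w; exists l.
exists (fun s => \sum_(x <- l (weight s) | x.2 == s) x.1) => n _.
have [N NP] := GP n; have [M MP] := mhs_series_p_integral n Gw.
exists (maxn N M) => p p_pr; rewrite geq_max => /andP[Np Mp].
rewrite (eq_fsbigr (fun s => (\sum_(x <- l (weight s) | x.2 == s) x.1)
  * p%:R ^+ weight s * nested_sum recip (val s) p)); last first.
  by move=> s _; rewrite mhsE prednK ?prime_gt0.
rewrite mhs_series_sum; last by move=> w; case: (lP w).
rewrite -(@eq_expansion (G^~ p)); last by move=> w; case: (lP w).
apply: padic_of_rat_congr => //; last exact: NP.
by apply: p_integral_expansion => // w wn; apply: MP.
Qed.

Theorem theorem4 (s : composition) (r : nat) (r_gt0 : (0 < r)%N) :
  asymptotically_representable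
    (fun p : nat =>
       padic_of_rat p (p%:R ^+ weight s * mhs_coprime s p (p * r))).
Proof.
apply: has_mhs_expansion_representable.
apply: has_mhs_expansion_eq (has_mhs_expansion_coprime r (valP s)) => p p_pr.
rewrite mhs_coprimeE //; congr (_ * _); case: (val s) => [|a t] //=.
(* The top index p r is a multiple of p and contributes 0, so the exclusive bound drops from p r + 1
   to p r. *)
by rewrite big_ord_recr /= /recip_coprime dvdn_mulr // mul0r addr0.
Qed.
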